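(* Fix $\varepsilon>0$. Let $du_0$ be a probability measure on $\mathbb{R}$ such that (ES) the moment of order $8q^2$ of $du_0$ is finite; (FE) $du_0$ admits a $\mathcal{C}^\infty$ density $u_0$ with respect to the Lebesgue measure and the entropy $\int_{\mathbb{R}}u_0\log(u_0)$ is finite. Then, for all $t>0$, the law $du_t^\varepsilon$ of $X_t$ has finite moments of all orders: $\int_{\mathbb{R}}|x|^N\,du_t^\varepsilon(x)<+\infty$ for all $N\in\mathbb{N}$.
   Context: Standing assumptions on the confining potential $V:\mathbb{R}\to\mathbb{R}$: (V-1) $V$ is an even polynomial with $\deg V=2m\ge 4$; (V-2) $V'(x)=0$ has exactly three solutions $a,-a,0$ with $a>0$, and $V''(a)>0$, $V''(0)<0$; (V-3) there are $C_2,C_4>0$ with $V(x)\ge C_4x^4-C_2x^2$ for all $x\in\mathbb{R}$; (V-4) $\lim_{x\to\pm\infty}V''(x)=+\infty$ and $V''(x)>0$ for all $x\ge a$; (V-5) $V''$ is convex; (V-6) $V(0)=0$. Standing assumptions on the interaction potential $F:\mathbb{R}\to\mathbb{R}$: (F-1) $F$ is an even polynomial with $\deg F=2n\ge 2$; (F-2) $F$ and $F''$ are convex; (F-3) $F(0)=0$. Put $q=\max\{m,n\}$. For $\varepsilon>0$ and an initial probability law $du_0$ with finite moment of order $8q^2$, $(X_t)_{t\ge0}$ is the unique strong solution of $$X_t=X_0+\sqrt{\varepsilon}B_t-\int_0^tV'(X_s)\,ds-\int_0^t (F'\ast u_s^\varepsilon)(X_s)\,ds,\qquad u_s^\varepsilon=\mathcal{L}(X_s),$$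 where $\mathcal{L}(X_0)=du_0$, $B$ is a standard Brownian motion, and $\ast$ is convolution. *)

(* Defs.v *)
From HB Require Import structures.
From mathcomp Require Import all_boot all_order all_algebra.
From mathcomp Require Import all_classical all_reals all_analysis.

Set Implicit Arguments.
Unset Strict Implicit.
Unset Printing Implicit Defensive.

Import Order.TTheory GRing.Theory Num.Theory.
Import numFieldNormedType.Exports.

Local Open Scope classical_set_scope.
Local Open Scope ring_scope.

(* [size p = d.+1] says that the polynomial [p] has degree [d].  Derivatives of
   [V] and [F] are the formal ones ([deriv], [derivn]); those of real functions
   are [derive1n]. *)

Definition even_polynomial (R : realType) (p : {poly R}) : Prop :=
  forall x : R, p.[- x] = p.[x].

Definition convex_on_line (R : realType) (f : R -> R) : Prop :=
  convex_function (E := R^o) [set: R^o] f.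

Record confining_potential (R : realType) (m : nat) (V : {poly R}) : Prop :=
  ConfiningPotential {
  confining_even : even_polynomial V ;
  confining_order : (2 <= m)%N ;
  confining_degree : size V = (2 * m).+1 ;
  confining_wells : exists a : R,
    [/\ 0 < a,
        forall x : R, (deriv V).[x] = 0 <-> [\/ x = a, x = - a | x = 0],
        0 < (derivn 2 V).[a],
        (derivn 2 V).[0] < 0 &
        forall x : R, a <= x -> 0 < (derivn 2 V).[x]] ;
  confining_growth : exists C2 C4 : R,
    [/\ 0 < C2, 0 < C4 &
        forall x : R, C4 * x ^+ 4 - C2 * x ^+ 2 <= V.[x]] ;
  confining_pinfty : (derivn 2 V).[x] @[x --> +oo] --> +oo ;
  confining_ninfty : (derivn 2 V).[x] @[x --> -oo] --> +oo ;
  confining_convex : convex_on_line (fun x => (derivn 2 V).[x]) ;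
  confining_zero : V.[0] = 0 }.

Record interaction_potential (R : realType) (n : nat) (F : {poly R}) : Prop :=
  InteractionPotential {
  interaction_even : even_polynomial F ;
  interaction_order : (1 <= n)%N ;
  interaction_degree : size F = (2 * n).+1 ;
  interaction_convex : convex_on_line (fun x => F.[x]) ;
  interaction_convex2 : convex_on_line (fun x => (derivn 2 F).[x]) ;
  interaction_zero : F.[0] = 0 }.

Definition finite_moment (R : realType) (mu : probability R R)
    (N : nat) : Prop :=
  (\int[mu]_x (`|x| ^+ N)%:E < +oo)%E.

Definition smooth (R : realType) (f : R -> R) : Prop :=
  forall (k : nat) (x : R), derivable (derive1n k f) x 1.

Definition is_density (R : realType) (mu : probability R R)
    (u : R -> R) : Prop :=
  (forall x, 0 <= u x) /\
  forall A : set R, measurable A ->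
    mu A = (\int[lebesgue_measure]_(x in A) (u x)%:E)%E.

(* The convention 0 log 0 = 0 holds since the product vanishes with [u x]. *)
Definition finite_entropy (R : realType) (u : R -> R) : Prop :=
  lebesgue_measure.-integrable [set: R] (fun x => (u x * ln (u x))%:E).

Section Processes.
Context (d : measure_display) (Omega : measurableType d) (R : realType)
  (P : probability Omega R).

(* Processes are families indexed by [R] of which only the times [0 <= t] are
   ever constrained. *)
Implicit Types B X : R -> {RV P >-> R}.

Definition ae_continuous_paths X : Prop :=
  {ae P, forall w, {within `[0, +oo[, continuous (fun t : R => X t w)}}.

Definition history B (D : set R) : set (set Omega) :=
  \bigcup_(s in D) preimage_set_system [set: Omega] (B s) measurable.

Definition increment B (s t : R) (w : Omega) : R := B t w - B s w.

(* Degenerate increments are allowed and equal 0; taking some of the [A i] to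
   be the whole line gives the product rule for subfamilies. *)
Definition independent_increments B : Prop :=
  forall (n : nat) (t : nat -> R) (A : nat -> set R),
    0 <= t 0%N -> (forall i, t i <= t i.+1) -> (forall i, measurable (A i)) ->
    P (\bigcap_(i in `I_n) (increment B (t i) (t i.+1) @^-1` A i)) =
    (\prod_(i < n) P (increment B (t i) (t i.+1) @^-1` A i))%E.

(* The second parameter of [normal_prob] is the standard deviation. *)
Record brownian_motion B : Prop := BrownianMotion {
  brownian_start : {ae P, forall w, B 0 w = 0} ;
  brownian_continuous : ae_continuous_paths B ;
  brownian_independent : independent_increments B ;
  brownian_gaussian : forall (s t : R) (A : set R),
    0 <= s -> s < t -> measurable A ->
    P (increment B s t @^-1` A) = normal_prob 0 (Num.sqrt (t - s)) A }.

Definition independent_of_process (X0 : {RV P >-> R}) B : Prop :=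
  forall (A : set R) (E : set Omega),
    measurable A -> <<s history B `[0, +oo[ >> E ->
    P (X0 @^-1` A `&` E) = (P (X0 @^-1` A) * P E)%E.

(* The filtration generated by [X0] and [B], augmented by the null sets. *)
Definition augmented_filtration (X0 : {RV P >-> R}) B (t : R) :
    set (set Omega) :=
  <<s preimage_set_system [set: Omega] X0 measurable `|` history B `[0, t]
      `|` P.-negligible >>.

Definition convolution (f : R -> R) (mu : probability R R)
    (x : R) : R :=
  \int[mu]_y f (x - y).

(* As the diffusion coefficient is constant, the equation is a pathwise
   integral equation.  The integrability fields only say that the convolution
   and the time integrals in it exist. *)
Record strong_solution (eps : R) (V F : {poly R}) (X0 : {RV P >-> R})
    B X : Prop := StrongSolution {
  solution_adapted : forall (t : R) (A : set R), 0 <= t -> measurable A ->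
    augmented_filtration X0 B t (X t @^-1` A) ;
  solution_continuous : ae_continuous_paths X ;
  solution_convolution : forall t x : R, 0 <= t ->
    (distribution P (X t)).-integrable [set: R]
      (fun y => ((deriv F).[x - y])%:E) ;
  solution_integrable : {ae P, forall w, forall t : R, 0 <= t ->
    lebesgue_measure.-integrable `[0, t]
      (fun s : R => ((deriv V).[X s w])%:E) /\
    lebesgue_measure.-integrable `[0, t]
      (fun s : R => (convolution (fun z => (deriv F).[z])
                       (distribution P (X s)) (X s w))%:E)} ;
  solution_equation : {ae P, forall w, forall t : R, 0 <= t ->
    X t w = X0 w + Num.sqrt eps * B t w
      - \int[lebesgue_measure]_(s in `[0, t]) (deriv V).[X s w]
      - \int[lebesgue_measure]_(s in `[0, t])
          convolution (fun z => (deriv F).[z])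
            (distribution P (X s)) (X s w)} }.

End Processes.

(* Main.v *)
(** Take two paths [X w] and [X w'] of the solution.  Both feel the same law [u_s], and
    [F' * u_s] is nondecreasing since [F] is convex, so the interaction never
    widens the gap [z] between them.  Since [V''] is even and convex,
    [V'(x) - V'(y) >= 2 V'((x - y) / 2)], which grows at least like [(x - y)^3].
    Apart from the noise, then, [z' <= - c z^3] as long as [z] is large: the gap
    comes down from infinity, and at time [t] it is at most a constant depending
    on [t] plus a multiple of the supremum over [[0, t]] of
    [sqrt eps |B w - B w'|].  Freezing one path [w'] bounds [|X_t w|] itself by a
    constant plus a multiple of [sup |B w|], whatever the initial law.

    The moments of [sup |B|] are finite by dyadic chaining, which needs only the
    Gaussian moments of the increments. *)

Require Import Defs.
From HB Require Import structures.
From mathcomp Require Import all_boot all_order all_algebra.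
From mathcomp Require Import all_classical all_reals all_analysis.
From mathcomp Require Import measurable_realfun ring lra.

Set Implicit Arguments.
Unset Strict Implicit.
Unset Printing Implicit Defensive.

Import Order.TTheory GRing.Theory Num.Theory.
Import numFieldNormedType.Exports.

Local Open Scope classical_set_scope.
Local Open Scope ring_scope.

(** * Polynomial potentials *)

Lemma convex_lineP (R : realType) (f : R -> R) : convex_on_line f ->
  forall (t x y : R), 0 <= t -> t <= 1 ->
  f (t * x + (1 - t) * y) <= t * f x + (1 - t) * f y.
Proof.
move=> cf t x y t0 t1.
have t01 : Itv.spec (@Itv.num_sem R)
    (Itv.Real `[Posz 0, Posz 1]%Z) t.
  by rewrite /= /Itv.num_sem/= num_real in_itv/= t0 t1.
have := cf (Itv.mk t01) x y; rewrite !inE => /(_ I I).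
by rewrite !convRE.
Qed.

(** On the segment from [x] to [y], parametrised by [h], convexity bounds the difference quotient at
    [h] by [p.[y] - p.[x]]; as [h] decreases to 0 the quotient tends to the left side. *)
Lemma convex_poly_tangent (R : realType) (p : {poly R}) :
  convex_on_line (fun x => p.[x]) ->
  forall x y : R, p^`().[x] * (y - x) <= p.[y] - p.[x].
Proof.
move=> cp x y.
pose q := p \Po (x%:P + (y - x) *: 'X).
have qE h : q.[h] = p.[x + (y - x) * h] by rewrite horner_comp !hornerE.
have q'0 : q^`().[0] = p^`().[x] * (y - x).
  rewrite deriv_comp !poly.derivE !hornerE horner_comp !hornerE.
  exact: mulr1.
have [dq Dq] := is_derive_poly q 0.
rewrite -q'0 -Dq.
apply: cvgr_to_le (cvg_dnbhs_at_right dq) _.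
near=> h => /=.
have h0 : 0 < h by near: h; exact: nbhs_right_gt.
have h1 : h < 1 by near: h; exact: nbhs_right_lt.
rewrite addr0 [_%:A]mulr1 -[_ *: _]/(_ * _) ler_pdivrMl// !qE mulr0 addr0.
have := convex_lineP cp y x (ltW h0) (ltW h1).
rewrite [X in p.[X]](_ : _ = x + (y - x) * h); last by ring.
lra.
Unshelve. all: by end_near.
Qed.

Lemma deriv_convex_poly_le (R : realType) (p : {poly R}) :
  convex_on_line (fun x => p.[x]) -> {homo horner p^`() : x y / x <= y}.
Proof.
move=> cp x y; rewrite le_eqVlt => /predU1P[->//|xy].
have := convex_poly_tangent cp x y; have := convex_poly_tangent cp y x.
nra.
Qed.

(** Evenness speaks of values, while formal derivatives need an identity of polynomials. The
    difference vanishes at as many distinct naturals as its size, too many for a nonzero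
    polynomial. *)
Lemma even_poly_comp (R : realType) (p : {poly R}) :
  even_polynomial p -> p \Po (- 'X) = p.
Proof.
move=> ep; apply/eqP; rewrite -subr_eq0; apply/negPn/negP => q0.
set q := _ - _ in q0.
have qx x : q.[x] = 0 by rewrite /q !hornerE horner_comp !hornerE ep subrr.
pose s := [seq (i%:R : R) | i <- iota 0 (size q)].
have /(max_poly_roots q0) : all (root q) s by apply/allP => x _; apply/eqP/qx.
rewrite size_map size_iota ltnn => H; apply: notF; apply: H.
by rewrite map_inj_uniq ?iota_uniq// => i j /eqP; rewrite eqr_nat => /eqP.
Qed.

Lemma deriv_even_poly (R : realType) (p : {poly R}) (x : R) :
  even_polynomial p -> p^`().[- x] = - p^`().[x].
Proof.
move=> /even_poly_comp ep; rewrite -{2}ep deriv_comp !poly.derivE !hornerE.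
by rewrite horner_comp !hornerE mulrN1 opprK.
Qed.

Lemma deriv2_even_poly (R : realType) (p : {poly R}) :
  even_polynomial p -> even_polynomial p^`(2).
Proof.
move=> ep x; have : (p^`() \Po - 'X) = - p^`().
  have := congr1 (fun q => q^`()) (even_poly_comp ep).
  by rewrite deriv_comp derivN derivX mulrN1 => /eqP; rewrite eqr_oppLR => /eqP.
move=> /(congr1 (fun q => q^`())); rewrite deriv_comp !derivN derivX mulrN1.
rewrite derivnS derivn1.
by move=> /oppr_inj E; rewrite -{2}E horner_comp hornerN hornerX.
Qed.

Lemma even_convex_le (R : realType) (f : R -> R) :
  (forall x, f (- x) = f x) -> convex_on_line f ->
  forall x y, `|x| <= y -> f x <= f y.
Proof.
move=> ef cf x y; have [->|y0] := eqVneq y 0; first by rewrite normr_le0 => /eqP->.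
move=> xy; have {}y0 : 0 < y by rewrite lt_neqAle eq_sym y0 (le_trans _ xy).
move: xy; rewrite ler_norml => /andP[xy yx].
pose t := (x + y) / (2 * y).
have t0 : 0 <= t by rewrite divr_ge0; lra.
have t1 : t <= 1 by rewrite ler_pdivrMr; lra.
have := convex_lineP cf y (- y) t0 t1.
have -> : t * y + (1 - t) * - y = x by rewrite /t; field; rewrite gt_eqF.
by rewrite ef; lra.
Qed.

(* The derivative of [c |-> p'(c + h) - p'(c - h)] is nonnegative on [c >= 0]
   because [p''] is nondecreasing in [|x|]; hence the minimum is at [c = 0]. *)
Lemma deriv_even_poly_sub_ge (R : realType) (p : {poly R}) :
  even_polynomial p -> convex_on_line (fun x => p^`(2).[x]) ->
  forall x y : R, y <= x -> 2 * p^`().[(x - y) / 2] <= p^`().[x] - p^`().[y].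
Proof.
move=> ep cp x y yx.
pose h := (x - y) / 2; have h0 : 0 <= h by rewrite divr_ge0 ?subr_ge0.
have odd_p' z := deriv_even_poly z ep.
(* With [c] the midpoint and [h] the half-distance, [x = c + h] and [y = c - h]. As [p'] is odd,
   replacing [(x, y)] by [(- y, - x)] changes neither side, so [c >= 0] may be assumed. *)
suff H (c : R) : 0 <= c -> 2 * p^`().[h] <= p^`().[c + h] - p^`().[c - h].
  have [c0|c0] := leP 0 ((x + y) / 2).
    have := H _ c0; rewrite -/h.
    have -> : (x + y) / 2 + h = x by rewrite /h; field.
    by have -> : (x + y) / 2 - h = y by rewrite /h; field.
  have /H : 0 <= - ((x + y) / 2) by rewrite oppr_ge0 ltW.
  have -> : - ((x + y) / 2) + h = - y by rewrite /h; field.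
  have -> : - ((x + y) / 2) - h = - x by rewrite /h; field.
  by rewrite !odd_p' -/h; lra.
move=> c0.
pose q := (p^`() \Po ('X + h%:P)) - (p^`() \Po ('X - h%:P)).
have qE z : q.[z] = p^`().[z + h] - p^`().[z - h].
  by rewrite /q hornerD hornerN !horner_comp !(hornerD, hornerN, hornerX, hornerC).
have q'E z : q^`().[z] = p^`(2).[z + h] - p^`(2).[z - h].
  rewrite /q derivD derivN !deriv_comp !(derivD, derivN, derivX, derivC).
  rewrite oppr0 addr0 !mulr1 hornerD hornerN !horner_comp.
  by rewrite !(hornerD, hornerN, hornerX, hornerC).
have [z zc] : exists2 z, z \in `[0, c] & q.[c] - q.[0] = q^`().[z] * (c - 0).
  apply: MVT_segment => //; apply: continuous_subspaceT.
  exact: continuous_horner.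
rewrite !qE q'E add0r sub0r odd_p' => E.
suff : p^`(2).[z - h] <= p^`(2).[z + h] by nra.
apply: even_convex_le (deriv2_even_poly ep) cp _ _ _.
by move: zc; rewrite in_itv/= ler_norml => /andP[? ?]; lra.
Qed.

(** [V'] increases on [[a, +oo[], so the mean value theorem gives [V(z) - V(a) <= V'(z) (z - a)];
    the quartic growth of [V] bounds the left side below by a multiple of [z^4], and division by [z]
    leaves a cube. *)
Lemma confining_deriv_ge (R : realType) (m : nat) (V : {poly R}) :
  confining_potential m V ->
  exists c z0 : R, [/\ 0 < c, 0 <= z0 &
    forall z, z0 <= z -> c * z ^+ 3 <= V^`().[z]].
Proof.
move=> hV; have [a [a0 _ _ _ V2]] := confining_wells hV.
have [C2 [C4 [C20 C40 VC]]] := confining_growth hV.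
pose A := `|V.[a]|.
have A0 : 0 <= A by exact: normr_ge0.
have VA : V.[a] <= A by exact: ler_norm.
have D0 : 0 <= 2 * (C2 + A) / C4 by rewrite divr_ge0 ?(ltW C40)//; lra.
(* Beyond this threshold [C4 z^2 >= 2 (C2 + A)], so half of [C4 z^4] absorbs both [C2 z^2] and
   [V(a)]. *)
exists (C4 / 2), (1 + a + (2 * (C2 + A)) / C4); split => [||z zz0].
- by rewrite divr_gt0.
- lra.
have z1 : 2 * (C2 + A) <= C4 * (z - 1 - a).
  by rewrite [leRHS]mulrC -ler_pdivrMr//; lra.
have az : 1 + a <= z by lra.
have V'mono u : u \in `[a, z] -> V^`().[u] <= V^`().[z].
  rewrite in_itv/= => /andP[au uz].
  have [v] : exists2 v, v \in `[u, z] &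
      V^`().[z] - V^`().[u] = V^`(2).[v] * (z - u).
    apply: (@MVT_segment _ (horner V^`()) (horner V^`(2))) => //.
    by apply: continuous_subspaceT; exact: continuous_horner.
  rewrite in_itv/= => /andP[uv _] E.
  by have := V2 v (le_trans au uv); nra.
have [u uaz E] : exists2 u, u \in `[a, z] &
    V.[z] - V.[a] = V^`().[u] * (z - a).
  apply: (@MVT_segment _ (horner V)) => //; first lra.
  by apply: continuous_subspaceT; exact: continuous_horner.
have Vu := V'mono u uaz.
have Vz := VC z.
have z21 : 1 <= z ^+ 2 by rewrite exprn_ege1//; lra.
have H1 : V.[z] - V.[a] <= V^`().[z] * (z - a) by rewrite E ler_wpM2r//; lra.
have H2 : (C4 / 2) * z ^+ 4 <= V.[z] - V.[a].
  have E4 : z ^+ 4 = z ^+ 2 * z ^+ 2 by ring.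
  have : 2 * (C2 + A) <= C4 * z ^+ 2 by nra.
  by rewrite E4 in Vz *; nra.
have V'0 : 0 <= V^`().[z].
  have : 0 <= V^`().[z] * (z - a).
    apply: le_trans (le_trans H2 H1).
    by rewrite mulr_ge0 ?exprn_ge0//; lra.
  by rewrite pmulr_lge0//; lra.
rewrite -(ler_pM2r (_ : 0 < z)); last lra.
have -> : C4 / 2 * z ^+ 3 * z = C4 / 2 * z ^+ 4 by ring.
by nra.
Qed.

Lemma confining_deriv_sub_ge (R : realType) (m : nat) (V : {poly R}) :
  confining_potential m V ->
  exists c z0 : R, [/\ 0 < c, 0 <= z0 & forall x y, z0 <= x - y ->
    c * (x - y) ^+ 3 <= V^`().[x] - V^`().[y]].
Proof.
move=> hV; have [c [z0 [c0 z00 H]]] := confining_deriv_ge hV.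
exists (c / 4), (2 * z0); split => [||x y xy]; [lra|lra|].
have := deriv_even_poly_sub_ge (confining_even hV) (confining_convex hV)
  (_ : y <= x).
have := H ((x - y) / 2); set w := x - y in xy *.
have -> : c * (w / 2) ^+ 3 = c / 8 * w ^+ 3 by field.
move=> /(_ ltac:(lra)) + /(_ ltac:(rewrite /w in xy; lra)).
lra.
Qed.

(** * Coming down from infinity *)

Lemma within_continuousP (R : realType) (A : set R) (f : R -> R) (x e : R) :
  {within A, continuous f} -> A x -> 0 < e ->
  exists2 r : R, 0 < r & forall y, A y -> `|y - x| < r -> `|f y - f x| < e.
Proof.
move=> /subspace_continuousP /(_ x) cf /cf /cvgrPdist_lt /(_ e) + e0.
move=> /(_ e0) [r /= r0 H]; exists r => // y Ay yx.
by rewrite distrC; apply: H => //=; rewrite distrC.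
Qed.

Lemma Rintegral_itv_ge (R : realType) (h : R -> R) (c r s : R) :
  r <= s -> (@lebesgue_measure R).-integrable `]r, s] (EFin \o h) ->
  (forall x, r < x <= s -> c <= h x) ->
  c * (s - r) <= \int[lebesgue_measure]_(x in `]r, s]) h x.
Proof.
move=> rs ih ch.
have lrs : (@lebesgue_measure R) `]r, s] = (s - r)%:E.
  rewrite lebesgue_measure_itv/= lte_fin -EFinB; case: ltP => // sr.
  have -> : s = r by apply/eqP; rewrite eq_le rs sr.
  by rewrite subrr.
have <- : \int[lebesgue_measure]_(x in `]r, s]) c = c * (s - r).
  by rewrite Rintegral_cst//= lrs.
apply: le_Rintegral => //.
have rsc : `]r, s] `<=` `[r, s] by apply: subset_itvr; rewrite bnd_simp.
have : (@lebesgue_measure R).-integrable `[r, s] (EFin \o cst c).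
  apply: continuous_compact_integrable (@segment_compact _ r s) _.
  by apply: continuous_subspaceT => x; exact: cvg_cst.
by apply: integrableS.
Qed.

(* Were [u T > A], then [u (T / 4 ^ j)] would at least double with each [j]. *)
Lemma coming_down (R : realType) (k T A C : R) (u h : R -> R) :
  0 < k -> 0 < T -> 0 < A -> 1 <= 3 / 4 * k * T * A ^+ 2 ->
  {within `[0, T], continuous u} ->
  (@lebesgue_measure R).-integrable `[0, T] (EFin \o h) ->
  (forall s, 0 <= s <= T ->
    u s = C - \int[lebesgue_measure]_(x in `[0, s]) h x) ->
  (forall s, 0 <= s <= T -> A < u s -> k * u s ^+ 3 <= h s) ->
  u T <= A.
Proof.
move=> k0 T0 A0 kTA cu ih uE hu; rewrite leNgt; apply/negP => AuT.
have incr r s c : 0 <= r -> r <= s -> s <= T ->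
    (forall x, r < x <= s -> c <= h x) -> u s + c * (s - r) <= u r.
  move=> r0 rs sT ch.
  rewrite !uE ?r0 ?(le_trans r0 rs) ?sT ?(le_trans rs sT)//.
  have ihs : (@lebesgue_measure R).-integrable `[0, s] (EFin \o h).
    by apply: integrableS ih => //; apply: subset_itvl; rewrite bnd_simp.
  have := @Rintegral_itvB R h (BLeft 0) (BRight s) r ihs.
  rewrite !bnd_simp => /(_ r0 rs) E.
  have := Rintegral_itv_ge rs _ ch; rewrite -E.
  suff : (@lebesgue_measure R).-integrable `]r, s] (EFin \o h) by move=> H /(_ H); lra.
  by apply: integrableS ihs => //; apply: subset_itvr; rewrite bnd_simp.
(* After the supremum [r] of the times with [u <= A], [u] is nonincreasing, so [u r >= u T > A]; by
   continuity no such time lies close to [r], a contradiction. *)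
have uA s : 0 <= s <= T -> A < u s.
  move=> s0T; rewrite ltNge; apply/negP => usA.
  pose S := [set x | 0 <= x <= T /\ u x <= A].
  have hS : has_sup S.
    by split; [exists s | exists T => x [/andP[]]].
  pose r := sup S.
  have uS x : S x -> x <= r by exact: ub_le_sup hS.2 x.
  have r0 : 0 <= r.
    by case/andP: (s0T) => s0 _; apply: le_trans s0 _; exact: uS.
  have rT : r <= T by apply: ge_sup hS.1 _ => x [/andP[]].
  have Ar : A < u r.
    apply: lt_le_trans AuT _.
    suff : u T + 0 * (T - r) <= u r by rewrite mul0r addr0.
    apply: incr => // x /andP[rx xT].
    have x0 : 0 <= x by rewrite ltW// (le_lt_trans r0).
    have Aux : A < u x.
      rewrite ltNge; apply/negP => uxA; move: rx; rewrite ltNge => /negP; apply.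
      by apply: uS; split; rewrite ?x0.
    apply: le_trans (hu x _ Aux); rewrite ?x0//.
    by rewrite mulr_ge0 ?exprn_ge0 ?ltW// (lt_trans A0).
  have [] := @within_continuousP _ _ _ r (u r - A) cu.
  - by rewrite /= in_itv/= r0.
  - by rewrite subr_gt0.
  move=> e e0 He; have [x Sx rx] := sup_adherent e0 hS.
  have xr : x <= r by exact: uS.
  have [x0T uxA] := Sx.
  have := He x; rewrite /= in_itv/= => /(_ x0T).
  rewrite !ltr_norml => H.
  have /andP[] : - (u r - A) < u x - u r < u r - A.
    by apply: H; rewrite -/r in rx; apply/andP; split; lra.
  lra.
(* Since [u] is nonincreasing, its rate of decrease on []r, s]] is at least the one computed from
   the endpoint value [u s]. *)
have step r s : 0 <= r -> r <= s -> s <= T -> u s + k * u s ^+ 3 * (s - r) <= u r.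
  move=> r0 rs sT.
  have hpos x : 0 <= x <= T -> 0 <= k * u x ^+ 3 <= h x.
    move=> x0T; rewrite hu ?uA// andbT.
    by rewrite mulr_ge0 ?exprn_ge0 ?ltW// (lt_trans A0)// uA.
  apply: (incr r s) => // x /andP[rx xs].
  have x0T : 0 <= x <= T by rewrite (le_trans xs)// andbT ltW// (le_lt_trans r0).
  have x0 : 0 <= x by case/andP: x0T.
  have s0T : 0 <= s <= T by rewrite (le_trans x0 xs).
  case/andP: (hpos x x0T) => _; apply: le_trans.
  rewrite ler_pM2l//; apply: lerXn2r; rewrite ?nnegrE.
  - by rewrite ltW// (lt_trans A0)// uA.
  - by rewrite ltW// (lt_trans A0)// uA.
  suff : u s + 0 * (s - x) <= u x by rewrite mul0r addr0.
  apply: incr => // y /andP[xy ys].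
  have y0T : 0 <= y <= T by rewrite (le_trans ys)// andbT ltW// (le_lt_trans x0).
  by case/andP: (hpos y y0T) => y0 yh; exact: le_trans y0 yh.
have pow4 j : 0 < (4 : R) ^- j <= 1.
  by rewrite invr_gt0 exprn_gt0//= invf_le1 ?exprn_gt0// exprn_ege1// ler1n.
have dbl j : 2 ^+ j * u T <= u (T * 4 ^- j).
  elim: j => [|j ih2]; first by rewrite !expr0 invr1 mulr1 mul1r.
  set r := T * 4 ^- j in ih2.
  have r0 : 0 < r by rewrite mulr_gt0//; case/andP: (pow4 j).
  have rT : r <= T by rewrite ger_pMr//; case/andP: (pow4 j).
  have -> : T * 4 ^- j.+1 = r / 4 by rewrite /r exprS; field; rewrite expf_neq0.
  apply: le_trans (step (r / 4) r _ _ rT); try lra.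
  have ur : A < u r by rewrite uA// (ltW r0).
  rewrite exprS -mulrA; apply: le_trans (_ : 2 * u r <= _).
    by rewrite ler_pM2l.
  (* As [r = T / 4^j] and [u r >= 2^j A], the product [r (u r)^2] is at least [T A^2]: the
     hypothesis at scale [T] persists at scale [r], and [u] loses at least [u r] between [r / 4] and
     [r]. *)
  have kru : 1 <= 3 / 4 * k * r * u r ^+ 2.
    apply: le_trans kTA _.
    have -> : 3 / 4 * k * T * A ^+ 2 = 3 / 4 * k * r * (2 ^+ j * A) ^+ 2.
      have E : (2 ^+ j) ^+ 2 = 4 ^+ j :> R.
        by rewrite -exprM mulnC exprM; congr (_ ^+ j); ring.
      by rewrite /r exprMn E; field; rewrite expf_neq0.
    rewrite ler_pM2l; last by rewrite !mulr_gt0 ?invr_gt0.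
    apply: lerXn2r; rewrite ?nnegrE ?mulr_ge0 ?exprn_ge0 ?(ltW A0)//.
      by rewrite ltW// (lt_trans A0).
    by apply: le_trans ih2; rewrite ler_pM2l ?exprn_gt0// ltW.
  have -> : k * u r ^+ 3 * (r - r / 4) = u r * (3 / 4 * k * r * u r ^+ 2) by field.
  have : 0 < u r by rewrite (lt_trans A0).
  nra.
(* Monotonicity puts [u 0] above all the doubled values, hence above every natural multiple of
   [u T], against the Archimedean property. *)
have u0T j : j%:R * u T <= u 0.
  have /andP[p0 p1] := pow4 j.
  have s0 : 0 <= T * 4 ^- j by rewrite mulr_ge0// ltW.
  have sT : T * 4 ^- j <= T by rewrite ger_pMr.
  have us : 0 < u (T * 4 ^- j) by rewrite (lt_trans A0)// uA// s0.
  have := step 0 (T * 4 ^- j) (lexx _) s0 sT.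
  apply: le_trans; apply: le_trans (_ : u (T * 4 ^- j) <= _); last first.
    by rewrite lerDl !mulr_ge0 ?exprn_ge0 ?subr0// ltW.
  apply: le_trans (dbl j); rewrite ler_pM2r ?(lt_trans A0)//.
  by rewrite -natrX ler_nat ltnW// ltn_expl.
have uT0 : 0 < u T by rewrite (lt_trans A0).
have u00 : 0 <= u 0 / u T.
  by rewrite divr_ge0 ?ltW// (lt_trans A0)// uA// lexx ltW.
have := archi_boundP u00; rewrite ltr_pdivrMr// ltNge.
by rewrite u0T.
Qed.

(** * Gaussian moments and dyadic chaining *)

(** The normal law is dominated by Lebesgue measure; its Radon-Nikodym derivative and [normal_pdf]
    have the same integral over every measurable set, so they agree almost everywhere. *)
Lemma ge0_integral_normal_prob (R : realType) (m s : R) f :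
  measurable_fun [set: R] f -> (forall x, 0 <= f x)%E ->
  (\int[normal_prob m s]_x f x =
   \int[lebesgue_measure]_x (f x * (normal_pdf m s x)%:E))%E.
Proof.
move=> mf f0; have dom := normal_prob_dominates m s.
rewrite -(Radon_Nikodym_SigmaFinite.change_of_variables dom)//=.
apply: ae_eq_integral => //.
- apply: emeasurable_funM => //; apply: (measurable_int lebesgue_measure).
  exact: Radon_Nikodym_SigmaFinite.f_integrable.
- apply: emeasurable_funM => //=; apply/measurable_EFinP.
  exact: measurable_normal_pdf.
- apply: ae_eqe_mul2l => /=; apply: integral_ae_eq => //=.
  + exact: Radon_Nikodym_SigmaFinite.f_integrable.
  + by apply/measurable_EFinP; exact: measurable_normal_pdf.
  + by move=> E _ mE; rewrite -Radon_Nikodym_SigmaFinite.f_integral.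
Qed.

(** Completing the square: an exponential tilt shifts the mean, here by [e * s] with [e] equal to 1
    or -1. *)
Lemma expR_normal_pdf (R : realType) (s e x : R) : s != 0 -> e ^+ 2 = 1 ->
  expR (e * x / s) * normal_pdf 0 s x = expR (2^-1) * normal_pdf (e * s) s x.
Proof.
move=> s0 e1; rewrite /normal_pdf (negbTE s0) /normal_fun.
rewrite !(mulrCA (expR _) (normal_peak s)) -!expRD; congr (_ * expR _).
have -> : (x - e * s) ^+ 2 = x ^+ 2 - 2 * e * s * x + e ^+ 2 * s ^+ 2 by ring.
by rewrite e1 -[s ^+ 2 *+ 2]mulr_natr; field.
Qed.

Lemma integral_normal_prob_expR (R : realType) (s e : R) :
  s != 0 -> e ^+ 2 = 1 ->
  (\int[normal_prob 0 s]_x (expR (e * x / s))%:E = (expR (2^-1))%:E)%E.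
Proof.
move=> s0 e1; rewrite ge0_integral_normal_prob//; last first.
  apply/measurable_EFinP/measurableT_comp => //.
  by apply: measurable_funM => //; exact: measurable_funM.
under eq_integral do rewrite -EFinM expR_normal_pdf// EFinM.
rewrite ge0_integralZl//=.
- by rewrite integral_normal_pdf mule1.
- by apply/measurable_EFinP; exact: measurable_normal_pdf.
- by move=> x _; rewrite lee_fin normal_pdf_ge0.
Qed.

(** For [y >= 0] the term [y^(n+1) / (n+1)!] of the exponential series is at most [expR y]; the sum
    of the two exponentials covers both signs. *)
Lemma normr_expn_le_expR (R : realType) (n : nat) (x : R) :
  `|x| ^+ n.+1 <= n.+1`!%:R * (expR x + expR (- x)).
Proof.
have H (y : R) : 0 <= y -> y ^+ n.+1 <= n.+1`!%:R * (expR y + expR (- y)).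
  move=> y0; have f0 : 0 < n.+1`!%:R :> R by rewrite ltr0n fact_gt0.
  rewrite mulrC -ler_pdivrMr//.
  have := expR_ge1Dxn n y0; have := expR_ge0 (- y); lra.
have [x0|x0] := leP 0 x; first by rewrite ger0_norm//; exact: H.
rewrite (ltr0_norm x0) [expR x + _]addrC.
by have := H (- x); rewrite opprK; apply; rewrite oppr_ge0 ltW.
Qed.

Lemma normal_prob_moment_le (R : realType) (n : nat) (s : R) : 0 < s ->
  (\int[normal_prob 0 s]_x (`|x| ^+ n.+1)%:E <=
   (n.+1`!%:R * (2 * expR (2^-1)) * s ^+ n.+1)%:E)%E.
Proof.
move=> s0; have sN0 : s != 0 by rewrite gt_eqF.
pose K : R := n.+1`!%:R * s ^+ n.+1.
have K0 : 0 <= K by rewrite mulr_ge0 ?exprn_ge0 ?ltW.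
have me e : measurable_fun [set: R] (fun x : R => (expR (e * x / s))%:E).
  apply/measurable_EFinP/measurableT_comp => //.
  by apply: measurable_funM => //; exact: measurable_funM.
apply: (@le_trans _ _ (\int[normal_prob 0 s]_x
    (K%:E * ((expR (1 * x / s))%:E + (expR (-1 * x / s))%:E)))%E).
  apply: ge0_le_integral => //=.
  - by apply/measurable_EFinP; apply: measurable_funX; exact: normr_measurable.
  - by apply: emeasurable_funM; [exact: measurable_cst|apply: emeasurable_funD; exact: me].
  - move=> x _; rewrite -EFinD -EFinM lee_fin mul1r mulN1r mulNr.
    rewrite /K -mulrA [s ^+ _ * _]mulrC mulrA -ler_pdivrMr ?exprn_gt0//.
    apply: le_trans (normr_expn_le_expR n (x / s)).
    by rewrite normrM normfV (gtr0_norm s0) expr_div_n.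
rewrite ge0_integralZl//; last 2 first.
- exact: emeasurable_funD (me _) (me _).
- by move=> x _; rewrite adde_ge0 ?lee_fin ?expR_ge0.
rewrite ge0_integralD//; last 2 first; [exact: me | exact: me |].
rewrite !integral_normal_prob_expR ?sqrrN ?expr1n//.
by rewrite -EFinD -EFinM lee_fin /K le_eqVlt; apply/orP; left; apply/eqP; ring.
Qed.

(** [f n k] stands for the value of a function at [k / 2^n]. A point new at level [n + 1] is one
    increment away from a point of level [n], so the bounds add up to a geometric series. *)
Lemma dyadic_bound (R : realType) (G : R) (f : nat -> nat -> R) :
  0 <= G ->
  (forall n k, f n.+1 k.*2 = f n k) -> f 0%N 0%N = 0 ->
  (forall n k, (k < 2 ^ n)%N -> `|f n k.+1 - f n k| <= G * (4 / 5) ^+ n) ->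
  forall n k, (k <= 2 ^ n)%N -> `|f n k| <= 5 * G.
Proof.
move=> G0 fS f00 df n k kn.
(* The right side is the sum of [G (4 / 5)^i] over [i <= n], the form that passes through the
   induction. *)
suff H : `|f n k| <= 5 * G * (1 - (4 / 5) ^+ n.+1).
  apply: le_trans H _; rewrite ler_piMr//; lra.
elim: n k kn => [|n IHn] k kn.
  rewrite expr1; case: k kn => [|[|//]] _; first by rewrite f00 normr0; lra.
  by have := df 0%N 0%N isT; rewrite f00 subr0 expr0; lra.
have e0 : 0 <= ((4 / 5) ^+ n.+1 : R) by rewrite exprn_ge0.
have eS : (4 / 5) ^+ n.+2 = 4 / 5 * (4 / 5) ^+ n.+1 :> R by rewrite exprS.
move: kn; rewrite expnS mul2n -[k]odd_double_half; set j := k./2.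
case: (odd k) => /=; rewrite ?add1n ?add0n => jn.
  have {}jn : (j < 2 ^ n)%N by rewrite -ltn_double.
  have := IHn j (ltnW jn); rewrite -fS => IHj.
  have := df n.+1 j.*2; rewrite expnS mul2n ltn_double => /(_ jn) dj.
  rewrite -[f _ _](subrK (f n.+1 j.*2)).
  apply: le_trans (ler_normD _ _) _; rewrite eS; nra.
rewrite fS; apply: le_trans (IHn j _) _; first by rewrite -leq_double.
rewrite eS; nra.
Qed.

(* Were all the scaled increments smaller than [`|b s|], [dyadic_bound] with
   [G = `|b s| / 6] would give [`|b s| <= 5 / 6 * `|b s|]. *)
Lemma dyadic_chaining (R : realType) (T : R) (b : R -> R) :
  0 < T -> {within `[0, T], continuous b} -> b 0 = 0 ->
  forall s, 0 <= s <= T -> exists n k, (k < 2 ^ n)%N /\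
    `|b s| <= 6 * (5 / 4) ^+ n *
      `|b (T * (k.+1%:R / 2 ^+ n)) - b (T * (k%:R / 2 ^+ n))|.
Proof.
move=> T0 cb b0 s /[dup] s0T /andP[s0 sT]; apply: contrapT => nex.
pose f n k := b (T * (k%:R / 2 ^+ n)).
have bs n k : (k < 2 ^ n)%N ->
    6 * (5 / 4) ^+ n * `|f n k.+1 - f n k| < `|b s|.
  by move=> kn; rewrite ltNge; apply/negP => H; apply: nex; exists n, k.
pose G := `|b s| / 6.
have G0 : 0 <= G by rewrite divr_ge0.
have bs0 : 0 < `|b s|.
  by apply: le_lt_trans (bs 0%N 0%N isT); rewrite !mulr_ge0.
have fG : forall n k, (k <= 2 ^ n)%N -> `|f n k| <= 5 * G.
  apply: dyadic_bound => //.
  - move=> n k; rewrite /f; congr (b (T * _)).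
    by rewrite -mul2n natrM exprS; field; rewrite expf_neq0.
  - by rewrite /f mul0r mulr0.
  - move=> n k /bs H; have p0 : 0 < ((5 / 4) ^+ n : R) by rewrite exprn_gt0.
    have -> : (4 / 5) ^+ n = ((5 / 4) ^+ n)^-1 :> R.
      by rewrite -exprVn; congr (_ ^+ n); field.
    rewrite ler_pdivlMr// /G; nra.
have {}fG n k : (k <= 2 ^ n)%N -> `|f n k| <= 5 * G by exact: fG.
(* Continuity at [s] carries the bound from a dyadic point just below [s] to [s] itself with an
   error less than [G]; then [|b s| < 5 G + G = |b s|]. *)
have [r r0 Hr] : exists2 r : R, 0 < r & forall y, y \in `[0, T] ->
    `|y - s| < r -> `|b y - b s| < G.
  by apply: within_continuousP => //; rewrite /G; lra.
have T2 n : 0 < T / 2 ^+ n by rewrite divr_gt0// exprn_gt0.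
have [n Tn] : exists n : nat, T / 2 ^+ n < r.
  have Tr : 0 <= T / r by rewrite divr_ge0// ltW.
  exists (Num.bound (T / r)); have := archi_boundP Tr.
  rewrite ltr_pdivrMr// => H; rewrite ltr_pdivrMr ?exprn_gt0//.
  apply: lt_trans H _; rewrite mulrC ltr_pM2l//.
  by rewrite -natrX ltr_nat ltn_expl.
pose k := Num.truncn (s / (T / 2 ^+ n)).
have st0 : 0 <= s / (T / 2 ^+ n) by rewrite divr_ge0// ltW.
have := truncn_itv st0; rewrite -/k => /andP[].
rewrite ler_pdivlMr// ltr_pdivrMr// => ks sk.
have kT : k%:R * (T / 2 ^+ n) <= T by exact: le_trans ks sT.
have kn : (k <= 2 ^ n)%N.
  rewrite -(ler_nat R) natrX -(ler_pM2r (T2 n)).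
  by apply: le_trans kT _; rewrite mulrC divfK// expf_neq0.
have kE : T * (k%:R / 2 ^+ n) = k%:R * (T / 2 ^+ n) by rewrite mulrCA.
have := fG n k kn; rewrite /f kE => H.
have : `|b (k%:R * (T / 2 ^+ n)) - b s| < G.
  apply: Hr; first by rewrite /= in_itv/= kT andbT mulr_ge0// ltW.
  rewrite distrC ger0_norm ?subr_ge0// ltrBlDr.
  by apply: lt_trans sk _; rewrite -natr1 mulrDl mul1r; lra.
have := ler_normB (b (k%:R * (T / 2 ^+ n))) (b (k%:R * (T / 2 ^+ n)) - b s).
by rewrite opprB addrCA subrr addr0 /G in H *; lra.
Qed.

(** * Supremum of Brownian motion *)

Lemma brownian_increment_moment (d : measure_display) (Omega : measurableType d)
    (R : realType) (P : probability Omega R) (B : R -> {RV P >-> R})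
    (s t : R) (n : nat) :
  brownian_motion B -> 0 <= s -> s < t -> (0 < n)%N ->
  (\int[P]_w (`|B t w - B s w| ^+ n)%:E <=
   (n`!%:R * (2 * expR (2^-1)) * Num.sqrt (t - s) ^+ n)%:E)%E.
Proof.
move=> hB s0 st; case: n => // n _.
(* [normal_prob] lives on [measurableTypeR R], random variables on [R]: the two
   measurable structures are convertible but not unifiable. *)
pose phi (w : Omega) : measurableTypeR R := B t w - B s w.
have mBts : measurable_fun [set: Omega] (fun w => B t w - B s w).
  exact: measurable_funB.
have mphi : measurable_fun [set: Omega] phi by exact: mBts.
pose phiM := isMeasurableFun.Build _ _ _ _ _ mphi.
pose D : {mfun Omega >-> measurableTypeR R} := HB.pack phi phiM.
have mf : measurable_fun [set: measurableTypeR R]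
    (fun x : measurableTypeR R => (`|x| ^+ n.+1)%:E).
  by apply/measurable_EFinP; apply: measurable_funX; exact: normr_measurable.
have := ge0_integral_distribution (P := P) D mf; rewrite /comp/= => <-; last first.
  by move=> x; rewrite lee_fin exprn_ge0.
rewrite (@eq_measure_integral _ (measurableTypeR R) R setT
  (normal_prob 0 (Num.sqrt (t - s))) (distribution P D)); last first.
  by move=> A mA _; exact: (brownian_gaussian hB s0 st mA).
by apply: normal_prob_moment_le; rewrite sqrtr_gt0 subr_gt0.
Qed.

Lemma geometric_nneseries_lty (R : realType) (a q : R) :
  0 <= a -> 0 < q -> q < 1 -> (\sum_(0 <= n <oo) (a * q ^+ n)%:E < +oo)%E.
Proof.
move=> a0 q0 q1; apply: (@le_lt_trans _ _ (a / (1 - q))%:E); last exact: ltry.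
apply: lime_le.
  by apply: is_cvg_nneseries => n _ _; rewrite lee_fin mulr_ge0// exprn_ge0// ltW.
apply: nearW => n; rewrite sumEFin lee_fin.
by apply: geometric_le_lim => //; rewrite ger0_norm// ltW.
Qed.

(** [S] sums the [2p]-th powers of all dyadic increments with their chaining weights. It dominates
    each single term, and as a countable sum it is measurable, so it can replace the supremum. *)
Lemma brownian_sup_moment (d : measure_display) (Omega : measurableType d)
    (R : realType) (P : probability Omega R) (B : R -> {RV P >-> R})
    (T : R) (p : nat) :
  brownian_motion B -> 0 < T -> (3 <= p)%N ->
  exists S : Omega -> \bar R,
    [/\ measurable_fun setT S, (forall w, 0 <= S w)%E, (\int[P]_w S w < +oo)%E &
      forall w, {within `[0, T], continuous (fun t => B t w)} -> B 0 w = 0 ->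
        forall s, 0 <= s <= T -> ((`|B s w| ^+ (2 * p))%:E <= S w)%E].
Proof.
move=> hB T0 p3; set N := (2 * p)%N.
have N0 : (0 < N)%N by rewrite muln_gt0/= (leq_trans _ p3).
pose tau n k : R := T * (k%:R / 2 ^+ n).
pose c n : R := (6 * (5 / 4) ^+ n) ^+ N.
have c0 n : 0 <= c n by rewrite exprn_ge0// mulr_ge0// exprn_ge0.
pose g n k w : \bar R :=
  ((c n)%:E * (`|B (tau n k.+1) w - B (tau n k) w| ^+ N)%:E)%E.
have mg0 n k : measurable_fun [set: Omega]
    (fun w => (`|B (tau n k.+1) w - B (tau n k) w| ^+ N)%:E).
  apply/measurable_EFinP; apply: measurable_funX.
  apply: measurableT_comp; first exact: normr_measurable.
  exact: measurable_funB.
have mg n k : measurable_fun [set: Omega] (g n k).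
  by apply: emeasurable_funM; [exact: measurable_cst|exact: mg0].
have g0 n k w : (0 <= g n k w)%E.
  by rewrite mule_ge0 ?lee_fin ?exprn_ge0.
pose h n w : \bar R := (\sum_(k < 2 ^ n) g n k w)%E.
have mh n : measurable_fun [set: Omega] (h n) by exact: emeasurable_sum.
have h0 n w : (0 <= h n w)%E by apply: sume_ge0.
exists (fun w => \sum_(0 <= n <oo) h n w)%E; split.
- by apply: ge0_emeasurable_sum => // n w _ _; exact: h0.
- by move=> w; apply: nneseries_ge0.
- rewrite integral_nneseries//.
  pose K : R := N`!%:R * (2 * expR 2^-1).
  have K0 : 0 <= K by rewrite !mulr_ge0 ?expR_ge0.
  (* Level [n] has [2^n] increments, with moments of order [(T / 2^n)^p] and weights of order
     [(25 / 16)^(n p)]. The bounds of consecutive levels thus have ratio [2 (25 / 32)^p], which is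
     below 1 for [p >= 3]. *)
  pose q : R := 2 * (25 / 32) ^+ p.
  have q0 : 0 < q by rewrite mulr_gt0// exprn_gt0.
  have q1 : q < 1.
    have : (25 / 32) ^+ p <= (25 / 32) ^+ 3 :> R.
      by apply: ler_wiXn2l => //; lra.
    by rewrite /q !exprS expr0; lra.
  have H n : (\int[P]_w h n w <= (6 ^+ N * K * T ^+ p * q ^+ n)%:E)%E.
    rewrite /h ge0_integral_sum//.
    pose A : R := c n * (K * (T / 2 ^+ n) ^+ p).
    apply: (@le_trans _ _ (\sum_(k < 2 ^ n) A)%:E).
      rewrite -sumEFin; apply: lee_sum => k _.
      rewrite /g ge0_integralZl//; last by rewrite lee_fin.
      rewrite /A EFinM; apply: lee_wpmul2l; first by rewrite lee_fin.
      have dtau : tau n k.+1 - tau n k = T / 2 ^+ n.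
        by rewrite /tau -natr1; field; rewrite expf_neq0.
      have dtau0 : 0 < T / 2 ^+ n by rewrite divr_gt0// exprn_gt0.
      have tau0 : 0 <= tau n k by apply: mulr_ge0; [exact: ltW|exact: divr_ge0].
      have := @brownian_increment_moment _ _ _ _ B (tau n k) (tau n k.+1) N hB tau0.
      rewrite -subr_gt0 dtau => /(_ dtau0 N0).
      have -> // : Num.sqrt (T / 2 ^+ n) ^+ N = (T / 2 ^+ n) ^+ p.
      by rewrite /N exprM sqr_sqrtr// ltW.
    rewrite lee_fin sumr_const card_ord -[_ *+ _]mulr_natl natrX.
    rewrite /A /c /q le_eqVlt; apply/orP; left; apply/eqP.
    (* Writing [(5 / 4)^2] as [2 * (25 / 32)] lets the powers of [2^n] cancel against the variance
       [T / 2^n]. *)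
    have E1 : ((5 / 4) ^+ n) ^+ N = ((25 / 32) ^+ n * 2 ^+ n) ^+ p :> R.
      rewrite /N exprM -exprMn; congr (_ ^+ p).
      by rewrite -exprM mulnC exprM; congr (_ ^+ n); field.
    have E2 : ((25 / 32) ^+ p) ^+ n = ((25 / 32) ^+ n) ^+ p :> R.
      by rewrite -!exprM mulnC.
    have E3 : ((25 / 32) ^+ n * 2 ^+ n) ^+ p * (T / 2 ^+ n) ^+ p =
        ((25 / 32) ^+ n) ^+ p * T ^+ p :> R.
      set a := (25 / 32) ^+ n; set b := 2 ^+ n; have b0 : b != 0 by exact: expf_neq0.
      by rewrite !exprMn exprVn mulrACA divff ?mulr1// expf_neq0.
    rewrite [(6 * _) ^+ N]exprMn E1 [(2 * _) ^+ n]exprMn E2.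
    rewrite -[RHS]mulrA [T ^+ p * _]mulrCA [T ^+ p * _]mulrC -E3.
    ring.
  have C0 : 0 <= 6 ^+ N * K * T ^+ p.
    by rewrite mulr_ge0 ?exprn_ge0 ?(ltW T0)// mulr_ge0// exprn_ge0.
  apply: le_lt_trans (geometric_nneseries_lty C0 q0 q1).
  apply: lee_nneseries => // n _ _; exact: integral_ge0.
- move=> w cB B0 s sT.
  have [n [k [kn H]]] := dyadic_chaining T0 cB B0 sT.
  apply: (@le_trans _ _ (g n k w)).
    rewrite /g -EFinM lee_fin /c -exprMn; apply: lerXn2r => //.
    by rewrite nnegrE !mulr_ge0 ?exprn_ge0.
  apply: (@le_trans _ _ (h n w)).
    by rewrite /h (bigD1 (Ordinal kn))//= leeDl// sume_ge0.
  apply: le_trans (@nneseries_lim_ge R (h ^~ w) xpredT 0 n.+1 _) => //.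
  by rewrite big_nat_recr//= leeDr// sume_ge0.
Qed.

(** * Comparison of two paths *)

(** Subtracting the noise leaves [u = (x - y) - (W - W')], whose increments are pure drift. Where
    [u > z0 + a + 2 M], the noise gap is below [u / 2], so [x - y] exceeds both [z0] and [u / 2]; as
    [b s] is monotone, the drift gap is at least [(c / 8) u^3]. At time [T] the noise adds back at
    most [M]. *)
Lemma pathwise_gap (R : realType) (p : R -> R) (b : R -> R -> R)
    (x y W W' : R -> R) (c z0 a T M C C' : R) :
  0 < c -> 0 <= z0 -> 0 < a -> 0 < T -> 0 <= M ->
  1 <= 3 / 4 * (c / 8) * T * a ^+ 2 ->
  (forall u v, z0 <= u - v -> c * (u - v) ^+ 3 <= p u - p v) ->
  (forall s, 0 <= s <= T -> {homo b s : u v / u <= v}) ->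
  {within `[0, T], continuous x} -> {within `[0, T], continuous y} ->
  {within `[0, T], continuous W} -> {within `[0, T], continuous W'} ->
  (forall s, 0 <= s <= T -> `|W s - W' s| <= M) ->
  (@lebesgue_measure R).-integrable `[0, T] (fun s => (p (x s))%:E) ->
  (@lebesgue_measure R).-integrable `[0, T] (fun s => (b s (x s))%:E) ->
  (@lebesgue_measure R).-integrable `[0, T] (fun s => (p (y s))%:E) ->
  (@lebesgue_measure R).-integrable `[0, T] (fun s => (b s (y s))%:E) ->
  (forall s, 0 <= s <= T -> x s = C + W s
    - \int[lebesgue_measure]_(r in `[0, s]) p (x r)
    - \int[lebesgue_measure]_(r in `[0, s]) b r (x r)) ->
  (forall s, 0 <= s <= T -> y s = C' + W' s
    - \int[lebesgue_measure]_(r in `[0, s]) p (y r)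
    - \int[lebesgue_measure]_(r in `[0, s]) b r (y r)) ->
  x T - y T <= z0 + a + 3 * M.
Proof.
move=> c0 z00 a0 T0 M0 cTa hp hb cx cy cW cW' WM ipx ibx ipy iby xE yE.
pose u s := (x s - y s) - (W s - W' s).
pose h s := (p (x s) + b s (x s)) - (p (y s) + b s (y s)).
have ix : (@lebesgue_measure R).-integrable `[0, T]
    (EFin \o (fun s => p (x s) + b s (x s))).
  exact: (integrableD _ ipx ibx).
have iy : (@lebesgue_measure R).-integrable `[0, T]
    (EFin \o (fun s => p (y s) + b s (y s))).
  exact: (integrableD _ ipy iby).
suff H : u T <= z0 + a + 2 * M.
  have TT : 0 <= T <= T by rewrite lexx ltW.
  have := WM _ TT; rewrite ler_norml => /andP[_ H1].
  by rewrite /u in H; lra.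
apply: (@coming_down R (c / 8) T _ (C - C') u h) => //.
- lra.
- lra.
(* The level [z0 + a + 2 M] is at least [a] whatever [M] is, so the condition on [a] suffices. *)
- apply: le_trans cTa _; rewrite ler_pM2l; last by rewrite !mulr_gt0// invr_gt0.
  by apply: lerXn2r; rewrite ?nnegrE; lra.
- by apply: within_continuousB; apply: within_continuousB.
- exact: (integrableB _ ix iy).
- move=> s s0T; rewrite /u xE// yE//.
  have sub : `[0, s] `<=` `[0, T].
    by apply: subset_itvl; rewrite bnd_simp; case/andP: s0T.
  have iS f : (@lebesgue_measure R).-integrable `[0, T] f ->
      (@lebesgue_measure R).-integrable `[0, s] f.
    exact: integrableS.
  rewrite /h RintegralB//; [|exact: iS..].
  rewrite !RintegralD//; [|exact: iS..].
  ring.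
- move=> s s0T; have := WM s s0T; rewrite ler_norml /u => /andP[W1 W2] Au.
  set w := W s - W' s in W1 W2 Au *; set z := x s - y s in Au *.
  have z0z : z0 <= z by lra.
  have yx : y s <= x s by rewrite -subr_ge0; apply: le_trans z0z.
  have := hp _ _ z0z; have := hb s s0T _ _ yx; rewrite -/z /h => H1 H2.
  have zu : (z - w) / 2 <= z by lra.
  have : ((z - w) / 2) ^+ 3 <= z ^+ 3.
    by apply: lerXn2r; rewrite ?nnegrE; lra.
  have -> : ((z - w) / 2) ^+ 3 = (z - w) ^+ 3 / 8 by field.
  rewrite -(ler_pM2l c0) => H3.
  have -> : c / 8 * (z - w) ^+ 3 = c * ((z - w) ^+ 3 / 8) by field.
  lra.
Qed.

Lemma convolution_deriv_homo (R : realType) (F : {poly R})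
    (mu : probability R R) :
  convex_on_line (fun x => F.[x]) ->
  (forall x, mu.-integrable [set: R] (fun y => (F^`().[x - y])%:E)) ->
  {homo convolution (fun z => F^`().[z]) mu : x y / x <= y}.
Proof.
move=> cF iF x y xy; apply: le_Rintegral; [by []|exact: iF|exact: iF|].
by move=> z _; apply: deriv_convex_poly_le => //; rewrite lerD2r.
Qed.

Lemma exprD_le (R : realDomainType) (n : nat) (x y : R) :
  0 <= x -> 0 <= y -> (x + y) ^+ n <= 2 ^+ n * (x ^+ n + y ^+ n).
Proof.
wlog xy : x y / x <= y => [H x0 y0|x0 y0].
  by have [xy|/ltW yx] := leP x y; [exact: H|rewrite addrC [_ ^+ n + _]addrC; exact: H].
apply: (@le_trans _ _ (2 ^+ n * y ^+ n)).
  by rewrite -exprMn; apply: lerXn2r; rewrite ?nnegrE; lra.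
by rewrite ler_pM2l ?exprn_gt0// lerDr exprn_ge0.
Qed.

Lemma normr_exp_le1D (R : realDomainType) (m n : nat) (x : R) :
  (m <= n)%N -> `|x| ^+ m <= 1 + `|x| ^+ n.
Proof.
move=> mn; have [x1|x1] := leP `|x| 1.
  by apply: (@le_trans _ _ 1); rewrite ?exprn_ile1// lerDl exprn_ge0.
apply: (@le_trans _ _ (`|x| ^+ n)); last by rewrite lerDr.
by rewrite ler_weXn2l// ltW.
Qed.

(** * Moments of the law of [X t] *)

Theorem propositionA2 (R : realType) (m n : nat) (V F : {poly R})
    (hV : confining_potential m V) (hF : interaction_potential n F)
    (eps : R) (heps : 0 < eps)
    (mu0 : probability R R)
    (hES : finite_moment mu0 (8 * maxn m n ^ 2))
    (hFE : exists u0 : R -> R,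
       [/\ smooth u0, is_density mu0 u0 & finite_entropy u0])
    (d : measure_display) (Omega : measurableType d) (P : probability Omega R)
    (X0 : {RV P >-> R}) (B X : R -> {RV P >-> R})
    (hX0 : forall A : set R, measurable A -> distribution P X0 A = mu0 A)
    (hB : brownian_motion B) (hX0B : independent_of_process X0 B)
    (hX : strong_solution eps V F X0 B X) :
  forall t : R, 0 < t -> forall N : nat, finite_moment (distribution P (X t)) N.
Proof.
move=> t t0 N.
have [c [z0 [c0 z00 hV']]] := confining_deriv_sub_ge hV.
(* Chosen so that [3 c t a^2 / 32 = (1 + 3 c t / 32) a], which is at least 1. *)
pose a := 1 + 32 / (3 * c * t).
have ct0 : 0 < 3 * c * t by rewrite !mulr_gt0.
have a0 : 0 < a by rewrite ltr_pDl// divr_gt0.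
have ca : 1 <= 3 / 4 * (c / 8) * t * a ^+ 2.
  have -> : 3 / 4 * (c / 8) * t * a ^+ 2 = (3 * c * t * a / 32) * a by field.
  have -> : 3 * c * t * a / 32 = 3 * c * t / 32 + 1.
    by rewrite /a; field; rewrite ?gt_eqF.
  have : 0 < 32 / (3 * c * t) by rewrite divr_gt0.
  by rewrite /a => ?; nra.
pose bc s := convolution (fun z => F^`().[z]) (distribution P (X s)).
have bc_homo s : 0 <= s <= t -> {homo bc s : u v / u <= v}.
  case/andP => s0 _; apply: convolution_deriv_homo.
    exact: interaction_convex hF.
  by move=> x; exact: solution_convolution hX s x s0.
(* Gathering the almost sure properties of a path in one predicate allows two individual outcomes to
   be compared, with no product space. *)
pose good w := [/\ B 0 w = 0,
  {within `[0, t], continuous (fun s => B s w)},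
  {within `[0, t], continuous (fun s => X s w)},
  (@lebesgue_measure R).-integrable `[0, t] (fun s => (V^`().[X s w])%:E) /\
  (@lebesgue_measure R).-integrable `[0, t] (fun s => (bc s (X s w))%:E) &
  forall s, 0 <= s <= t -> X s w = X0 w + Num.sqrt eps * B s w
    - \int[lebesgue_measure]_(r in `[0, s]) V^`().[X r w]
    - \int[lebesgue_measure]_(r in `[0, s]) bc r (X r w)].
have sub : `[0, t] `<=` `[0, +oo[ by apply: subset_itvl.
have aegood : {ae P, forall w, good w}.
  near=> w.
  have cB : {within `[0, +oo[, continuous (fun s => B s w)}.
    by near: w; exact: brownian_continuous hB.
  have cX : {within `[0, +oo[, continuous (fun s => X s w)}.
    by near: w; exact: solution_continuous hX.
  have I : forall s : R, 0 <= s ->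
      (@lebesgue_measure R).-integrable `[0, s] (fun r => (V^`().[X r w])%:E) /\
      (@lebesgue_measure R).-integrable `[0, s] (fun r => (bc r (X r w))%:E).
    by near: w; exact: solution_integrable hX.
  split.
  - by near: w; exact: brownian_start hB.
  - exact: continuous_subspaceW cB.
  - exact: continuous_subspaceW cX.
  - exact: I (ltW t0).
  - move=> s /andP[s0 _]; move: s s0; near: w; exact: solution_equation hX.
(* The good outcomes have full probability, so one exists. It is frozen from here on, and whatever
   depends on it alone is a constant. *)
have [w0 gw0] : exists w, good w.
  have PT : (0 < P [set: Omega])%E by rewrite probability_setT.
  exact: (@filter_ex _ _ (ae_properfilter_algebraOfSetsType PT) _ aegood).
(* The maximum with 3 makes the chaining series converge; the resulting order [q >= N] then controls
   order [N]. *)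
have [S [mS S0 iS HS]] := brownian_sup_moment hB t0 (leq_maxr N 3).
set q := (2 * maxn N 3)%N in HS.
have Nq : (N <= q)%N by exact: leq_trans (leq_maxl N 3) (leq_pmull _ _).
have Bmax w : good w -> exists2 s, 0 <= s <= t &
    forall r, 0 <= r <= t -> `|B r w| <= `|B s w|.
  move=> [_ cB _ _ _].
  have [s st H] := @EVT_max R (fun s => `|B s w|) 0 t (ltW t0)
    (fun s => cvg_norm (cB s)).
  by exists s => [|r rt]; [|apply: H]; rewrite ?in_itv//= in st *.
have [s0 s0t Bs0] := Bmax w0 gw0.
pose e := Num.sqrt eps.
have e0 : 0 <= e by exact: sqrtr_ge0.
have gap w w' M : good w -> good w' -> 0 <= M ->
    (forall r, 0 <= r <= t -> `|e * B r w - e * B r w'| <= M) ->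
    X t w - X t w' <= z0 + a + 3 * M.
  move=> [_ cB cX [iV iF] E] [_ cB' cX' [iV' iF'] E'] M0 HM.
  apply: (@pathwise_gap R (horner V^`()) bc (X ^~ w) (X ^~ w')
    (fun s => e * B s w) (fun s => e * B s w') c z0 a t M (X0 w) (X0 w')) => //.
  - by move=> s; apply: cvgMl_tmp; exact: cB.
  - by move=> s; apply: cvgMl_tmp; exact: cB'.
pose D := `|X t w0| + (z0 + a + 3 * (e * `|B s0 w0|)).
have D0 : 0 <= D.
  have : 0 <= e * `|B s0 w0| by rewrite mulr_ge0.
  by have := normr_ge0 (X t w0); rewrite /D; lra.
have key w : good w -> ((`|X t w| ^+ N)%:E <=
    (1 + 2 ^+ q * D ^+ q)%:E + (2 ^+ q * (3 * e) ^+ q)%:E * S w)%E.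
  move=> gw; have [s st Bs] := Bmax w gw.
  pose M := e * `|B s w| + e * `|B s0 w0|.
  have M0 : 0 <= M by rewrite addr_ge0// mulr_ge0.
  have HM r : 0 <= r <= t -> `|e * B r w - e * B r w0| <= M.
    move=> rt; apply: le_trans (ler_normB _ _) _; rewrite !normrM (ger0_norm e0).
    by apply: lerD; apply: ler_wpM2l => //; [exact: Bs|exact: Bs0].
  have HM' r : 0 <= r <= t -> `|e * B r w0 - e * B r w| <= M.
    by move=> /HM; rewrite distrC.
  (* The gap estimate is used in both orders, to bound [X t w - X t w0] from above and from
     below. *)
  have XD : `|X t w| <= D + 3 * e * `|B s w|.
    have := gap w w0 M gw gw0 M0 HM; have := gap w0 w M gw0 gw M0 HM'.
    have := ler_norm (X t w0); have := ler_norm (- X t w0); rewrite normrN.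
    by rewrite ler_norml /D /M => *; apply/andP; split; lra.
  have SB : ((`|B s w| ^+ q)%:E <= S w)%E.
    by case: gw => B0 cB _ _ _; exact: HS.
  apply: (@le_trans _ _
      ((1 + 2 ^+ q * D ^+ q)%:E + (2 ^+ q * (3 * e) ^+ q)%:E * (`|B s w| ^+ q)%:E)%E).
    rewrite -EFinM -EFinD lee_fin -addrA.
    apply: le_trans (normr_exp_le1D _ Nq) _; rewrite lerD2l.
    have eB : 0 <= 3 * e * `|B s w| by rewrite !mulr_ge0.
    apply: le_trans (_ : (D + 3 * e * `|B s w|) ^+ q <= _).
      by apply: lerXn2r; rewrite ?nnegrE// addr_ge0.
    apply: le_trans (exprD_le q D0 eB) _.
    by rewrite mulrDr exprMn mulrA.
  by rewrite leeD2l// lee_wpmul2l// lee_fin mulr_ge0 ?exprn_ge0// mulr_ge0.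
rewrite /finite_moment ge0_integral_distribution//; last first.
  by apply/measurable_EFinP; apply: measurable_funX; exact: normr_measurable.
apply: (@le_lt_trans _ _ (\int[P]_w
    ((1 + 2 ^+ q * D ^+ q)%:E + (2 ^+ q * (3 * e) ^+ q)%:E * S w))%E).
  apply: ae_ge0_le_integral => //=.
  - apply/measurable_EFinP; apply: measurable_funX.
    by apply: measurableT_comp => //; exact: normr_measurable.
  - move=> w _; apply: adde_ge0; first by rewrite lee_fin addr_ge0// mulr_ge0 ?exprn_ge0.
    by rewrite mule_ge0// lee_fin mulr_ge0 ?exprn_ge0// mulr_ge0.
  - apply: emeasurable_funD => //; apply: emeasurable_funM => //.
  - by apply: filterS aegood => w gw _; exact: key.
rewrite ge0_integralD//=; last 3 first.
- by move=> w _; rewrite lee_fin addr_ge0// mulr_ge0 ?exprn_ge0.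
- by move=> w _; rewrite mule_ge0// lee_fin mulr_ge0 ?exprn_ge0// mulr_ge0.
- by apply: emeasurable_funM.
rewrite integral_cst//= probability_setT mule1 ge0_integralZl//; last first.
  by rewrite lee_fin mulr_ge0 ?exprn_ge0// mulr_ge0.
by rewrite lte_add_pinfty ?ltry// lte_mul_pinfty// lee_fin mulr_ge0 ?exprn_ge0// mulr_ge0.
Unshelve. all: by end_near. Qed.
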